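(* Let $J$ be the ideal of a non-trivial tetrahedral curve $(a_1,\dots,a_6)$. (a) If the curve is minimal, then $J$ has a linear resolution, and hence is componentwise linear. (b) If, up to a permutation of the variables, the curve is $(0,r,r,r,r,0)$ for some $r\ge 1$, then $J$ has a pure resolution that is not linear, and hence $J$ is not componentwise linear. (c) Suppose the curve is not minimal, and that $J$ reduces to a tetrahedral curve with ideal $I$ by one of the reductions (A), (B), (C), (D), applied at a facet of maximal weight, so that $J=L\cdot I+(F)$ with $L$ and $F$ the linear form and monomial prescribed by that reduction. Then $F$ is a minimal generator of $I$ if and only if, up to a permutation of the variables, the curve of $J$ is $(0,r,r,r,r,0)$ for some $r\ge1$.
   Context: Let $k$ be a field and $R=k[a,b,c,d]$. For nonnegative integers $a_1,\dots,a_6$, the tetrahedral curve $(a_1,\dots,a_6)$ is the curve in $\mathbb P^3$ with ideal $(a,b)^{a_1}\cap(a,c)^{a_2}\cap(a,d)^{a_3}\cap(b,c)^{a_4}\cap(b,d)^{a_5}\cap(c,d)^{a_6}$; it is trivial if all $a_i=0$. A permutation of $a,b,c,d$ permutes these six ideals and hence the entries of the 6-tuple. The four facets are the triples of entries $\{a_1,a_2,a_3\}$, $\{a_1,a_4,a_5\}$, $\{a_2,a_4,a_6\}$, $\{a_3,a_5,a_6\}$; the weight of a facet is the sum of its entries. Put $a_i'=\max\{0,a_i-1\}$. Reductions: (A) if $a_1+a_2\ge a_4$, $a_1+a_3\ge a_5$, $a_2+a_3\ge a_6$, then $J=a\cdot I+(b^{a_1}c^{a_2}d^{a_3})$ with $I$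 the ideal of $(a_1',a_2',a_3',a_4,a_5,a_6)$; (B) if $a_1+a_4\ge a_2$, $a_1+a_5\ge a_3$, $a_4+a_5\ge a_6$, then $J=b\cdot I+(a^{a_1}c^{a_4}d^{a_5})$ with $I$ the ideal of $(a_1',a_2,a_3,a_4',a_5',a_6)$; (C) if $a_2+a_4\ge a_1$, $a_2+a_6\ge a_3$, $a_4+a_6\ge a_5$, then $J=c\cdot I+(a^{a_2}b^{a_4}d^{a_6})$ with $I$ the ideal of $(a_1,a_2',a_3,a_4',a_5,a_6')$; (D) if $a_3+a_5\ge a_1$, $a_3+a_6\ge a_2$, $a_5+a_6\ge a_4$, then $J=d\cdot I+(a^{a_3}b^{a_5}c^{a_6})$ with $I$ the ideal of $(a_1,a_2,a_3',a_4,a_5',a_6')$. Reduction (A),(B),(C),(D) is ''at'' the facet $\{a_1,a_2,a_3\}$, $\{a_1,a_4,a_5\}$, $\{a_2,a_4,a_6\}$, $\{a_3,a_5,a_6\}$ respectively. A non-arithmetically Cohen–Macaulay tetrahedral curve is minimal if none of the reductions (A)–(D) applies. (Known: if a non-trivial tetrahedral curve is not minimal, a reduction at any facet of maximal weight is possible.) A homogeneous ideal has a linear resolution if it is generated in one degree $d$ and the $i$-th module of its minimal free resolution is generated in degree $d+i$; it is componentwise linear if for every $d$ the ideal generated by its degree-$d$ component has a linear resolution. *)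

(* Defs.v *)
From HB Require Import structures.
From mathcomp Require Import all_boot all_order all_algebra all_fingroup.
From mathcomp Require Import mpoly.
Unset Printing Implicit Defensive.
Import GRing.Theory.
Local Open Scope ring_scope.

(* The ring R = k[a,b,c,d]; variables a,b,c,d are 'X_0,'X_1,'X_2,'X_3. *)
Notation Pol k := {mpoly k[4]}.
Definition var (k : fieldType) (i : nat) : Pol k := 'X_(inord i).

(* p is homogeneous of degree d (standard grading; 0 is homogeneous of every degree) *)
Definition is_homog (k : fieldType) (d : nat) (p : Pol k) : bool :=
  p \is @ishomog1 4 k d mdeg.

Definition ideal_span (k : fieldType) (S : Pol k -> Prop) : Pol k -> Prop :=
  fun p => exists (n : nat) (r s : 'I_n -> Pol k),
    (forall j, S (s j)) /\ p = \sum_(j < n) r j * s j.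

Definition ideal_mul (k : fieldType) (I K : Pol k -> Prop) : Pol k -> Prop :=
  ideal_span k (fun p => exists f g, I f /\ K g /\ p = f * g).

Fixpoint ideal_pow (k : fieldType) (I : Pol k -> Prop) (n : nat) : Pol k -> Prop :=
  match n with
  | 0 => fun _ => True
  | n.+1 => ideal_mul k (ideal_pow k I n) I
  end.

Definition var_ideal (k : fieldType) (i j : nat) : Pol k -> Prop :=
  ideal_span k (fun p => p = var k i \/ p = var k j).

Definition max_ideal (k : fieldType) : Pol k -> Prop :=
  ideal_span k (fun p => exists i : 'I_4, p = 'X_i).

Record tcurve := TC { a1 : nat; a2 : nat; a3 : nat; a4 : nat; a5 : nat; a6 : nat }.

Definition tet_ideal (k : fieldType) (C : tcurve) : Pol k -> Prop :=
  fun p =>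
    ideal_pow k (var_ideal k 0 1) (a1 C) p /\
    ideal_pow k (var_ideal k 0 2) (a2 C) p /\
    ideal_pow k (var_ideal k 0 3) (a3 C) p /\
    ideal_pow k (var_ideal k 1 2) (a4 C) p /\
    ideal_pow k (var_ideal k 1 3) (a5 C) p /\
    ideal_pow k (var_ideal k 2 3) (a6 C) p.

Definition nontrivial (C : tcurve) : Prop :=
  ~ (a1 C = 0 /\ a2 C = 0 /\ a3 C = 0 /\ a4 C = 0 /\ a5 C = 0 /\ a6 C = 0)%N.

(* exponent of the line {x_i = x_j = 0}, i.e. the entry of the 6-tuple
   attached to the pair {i,j} of variables (0=a,1=b,2=c,3=d) *)
Definition tentry (C : tcurve) (i j : nat) : nat :=
  match i, j with
  | 0, 1 | 1, 0 => a1 C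
  | 0, 2 | 2, 0 => a2 C
  | 0, 3 | 3, 0 => a3 C
  | 1, 2 | 2, 1 => a4 C
  | 1, 3 | 3, 1 => a5 C
  | 2, 3 | 3, 2 => a6 C
  | _, _ => 0%N
  end.

Definition special_curve (C : tcurve) : Prop :=
  exists (s : {perm 'I_4}) (r : nat), (0 < r)%N /\
    forall i j : 'I_4, i != j ->
      tentry C (s i) (s j) = tentry (TC 0 r r r r 0) i j.

Inductive facet := FA | FB | FC | FD.

Definition facet_weight (C : tcurve) (X : facet) : nat :=
  match X with
  | FA => a1 C + a2 C + a3 C
  | FB => a1 C + a4 C + a5 C
  | FC => a2 C + a4 C + a6 C
  | FD => a3 C + a5 C + a6 C
  end.

Definition red_cond (C : tcurve) (X : facet) : Prop :=
  match X with
  | FA => (a1 C + a2 C >= a4 C /\ a1 C + a3 C >= a5 C /\ a2 C + a3 C >= a6 C)%N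
  | FB => (a1 C + a4 C >= a2 C /\ a1 C + a5 C >= a3 C /\ a4 C + a5 C >= a6 C)%N
  | FC => (a2 C + a4 C >= a1 C /\ a2 C + a6 C >= a3 C /\ a4 C + a6 C >= a5 C)%N
  | FD => (a3 C + a5 C >= a1 C /\ a3 C + a6 C >= a2 C /\ a5 C + a6 C >= a4 C)%N
  end.

(* the curve of the ideal I in the reduction J = L*I + (F); a' = max{0,a-1} = a.-1 *)
Definition red_target (C : tcurve) (X : facet) : tcurve :=
  match X with
  | FA => TC (a1 C).-1 (a2 C).-1 (a3 C).-1 (a4 C) (a5 C) (a6 C)
  | FB => TC (a1 C).-1 (a2 C) (a3 C) (a4 C).-1 (a5 C).-1 (a6 C)
  | FC => TC (a1 C) (a2 C).-1 (a3 C) (a4 C).-1 (a5 C) (a6 C).-1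
  | FD => TC (a1 C) (a2 C) (a3 C).-1 (a4 C) (a5 C).-1 (a6 C).-1
  end.

Definition red_linear (k : fieldType) (X : facet) : Pol k :=
  match X with FA => var k 0 | FB => var k 1 | FC => var k 2 | FD => var k 3 end.

Definition red_mono (k : fieldType) (C : tcurve) (X : facet) : Pol k :=
  match X with
  | FA => var k 1 ^+ a1 C * var k 2 ^+ a2 C * var k 3 ^+ a3 C
  | FB => var k 0 ^+ a1 C * var k 2 ^+ a4 C * var k 3 ^+ a5 C
  | FC => var k 0 ^+ a2 C * var k 1 ^+ a4 C * var k 3 ^+ a6 C
  | FD => var k 0 ^+ a3 C * var k 1 ^+ a5 C * var k 2 ^+ a6 C
  end.

Definition tet_minimal (C : tcurve) : Prop := forall X, ~ red_cond C X.

(* A graded free resolution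
     0 <- J <- F_0 <-M_0- F_1 <-M_1- F_2 <- ... ,  F_i = R(-D i)^(b i),
   with row-vector convention (v |-> v *m M).  The augmentation F_0 -> J is
   given by the column G of generators (of degree D 0); the entries of M i
   are homogeneous of degree D (i+1) - D i, and D is strictly increasing,
   so all entries lie in the maximal ideal: the resolution is minimal.
   F_i is generated in the single degree D i.  The resolution is finite. *)
Definition graded_min_res (k : fieldType) (J : Pol k -> Prop)
  (b : nat -> nat) (D : nat -> nat)
  (G : 'M[Pol k]_(b 0, 1)) (M : forall i, 'M[Pol k]_(b i.+1, b i)) : Prop :=
  (forall i, D i < D i.+1)%N /\
  (forall j, is_homog k (D 0) (G j 0)) /\
  (forall i r c, is_homog k (D i.+1 - D i) (M i r c)) /\
  (forall p, J p <-> exists v : 'rV[Pol k]_(b 0), p = (v *m G) 0 0) /\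
  (forall v : 'rV[Pol k]_(b 0),
      v *m G = 0 <-> exists w : 'rV[Pol k]_(b 1), v = w *m M 0) /\
  (forall i (v : 'rV[Pol k]_(b i.+1)),
      v *m M i = 0 <-> exists w : 'rV[Pol k]_(b i.+2), v = w *m M i.+1) /\
  (exists n, forall i, (n < i)%N -> b i = 0%N).

Definition has_linear_res (k : fieldType) (J : Pol k -> Prop) : Prop :=
  exists (d : nat) (b : nat -> nat) G M, graded_min_res k J b (fun i => d + i)%N G M.

Definition has_pure_res (k : fieldType) (J : Pol k -> Prop) : Prop :=
  exists (b D : nat -> nat) G M, graded_min_res k J b D G M.

Definition comp_linear (k : fieldType) (J : Pol k -> Prop) : Prop :=
  forall d : nat, has_linear_res k (ideal_span k (fun p => J p /\ is_homog k d p)).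

Definition min_generator (k : fieldType) (I : Pol k -> Prop) (F : Pol k) : Prop :=
  I F /\ ~ ideal_mul k (max_ideal k) I F.

(* Main.v *)
Require Import Defs.
From HB Require Import structures.
From mathcomp Require Import all_boot all_order all_algebra all_fingroup.
From mathcomp Require Import mpoly.
From mathcomp Require Import zify.

(* Tetrahedral ideals are monomial: [tet_ideal C] is spanned by the monomials
   whose exponents satisfy six inequalities, one per edge.

   Resolutions come from mapping cones: if [I] and the colon ideal [I : f] have
   pure resolutions with compatible degrees, the cone of a homogeneous lift of
   multiplication by [f] is a pure resolution of [I + (f)].  So monomials of one
   degree with linear quotients (each successive colon ideal is generated by
   variables) generate an ideal with a linear resolution.

   (a) If no reduction applies then, up to relabelling, [a1 > a2 + a4],
   [a1 > a3 + a5], [a6 > a2 + a3] and [a6 > a4 + a5].  For every [d] the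
   monomials of degree [d] in such an ideal have linear quotients for the
   lexicographic order of [(deg_a + deg_b, deg_a, |deg_c - a2|)]: when [deg_a]
   cannot be lowered because [deg_a + deg_c = a2] or [deg_a + deg_d = a3],
   moving [deg_c] towards [a2] stays inside the ideal.

   (b) A special ideal is [(ab, cd)^r].  The successive colon ideals of
   [(cd)^r, ab(cd)^(r-1), ...] are [(cd)], whence a pure resolution.  These
   generators have no nonzero linear syzygy, so a linear resolution would miss
   the relation [cd * ab(cd)^(r-1) = ab * (cd)^r].

   (c) The monomial [F] is a minimal generator of the monomial ideal [I] iff [F]
   is in [I] and no [F / x] is; for a facet of maximal weight these inequalities
   leave only the special curves. *)

Set Implicit Arguments.
Unset Strict Implicit.
Unset Printing Implicit Defensive.
Import Order.TTheory GRing.Theory.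
Local Open Scope ring_scope.

(** The shifts [D] are an explicit parameter because a mapping cone compares the shifts of two
    resolutions. *)
Definition pure_res (k : fieldType) (D : nat -> nat) (J : Pol k -> Prop) :=
  exists b G M, graded_min_res k J b D G M.

(** * Homogeneous lifts through homogeneous matrices *)

Section HomogeneousLift.
Variable k : fieldType.
Implicit Types p q : Pol k.

Lemma pihomogM d e p q : is_homog k e q ->
  pihomog mdeg (d + e) (p * q) = pihomog mdeg d p * q.
Proof.
move=> hq; rewrite [p in LHS]mpolyE mulr_suml raddf_sum /= pihomogE mulr_suml.
rewrite [RHS]big_mkcond /=; apply: eq_bigr => m _.
rewrite -scalerAl linearZ /=.
have hX : 'X_[m] * q \is (mdeg m + e).-homog for mdeg.
  by apply: dhomogM hq; rewrite dhomogX.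
case: eqVneq => [<-|ne]; first by rewrite pihomog_dE // scalerAl.
by rewrite (pihomog_ne0 _ hX) ?scaler0 ?eqn_add2r.
Qed.

Definition mx_homog d m n (A : 'M[Pol k]_(m, n)) :=
  [forall i, forall j, is_homog k d (A i j)].

Lemma mx_homogP d m n (A : 'M[Pol k]_(m, n)) :
  reflect (forall i j, is_homog k d (A i j)) (mx_homog d A).
Proof. by apply: (iffP forallP) => h i; apply/forallP. Qed.

Lemma mx_homogM d e m n r (A : 'M[Pol k]_(m, n)) (B : 'M_(n, r)) :
  mx_homog d A -> mx_homog e B -> mx_homog (d + e) (A *m B).
Proof.
move=> /mx_homogP hA /mx_homogP hB; apply/mx_homogP => i j.
by rewrite mxE /is_homog rpred_sum // => l _; apply: dhomogM; [apply: hA|apply: hB].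
Qed.

Lemma mx_homogN d m n (A : 'M[Pol k]_(m, n)) : mx_homog d A -> mx_homog d (- A).
Proof.
by move=> /mx_homogP hA; apply/mx_homogP => i j; rewrite mxE /is_homog rpredN; apply: hA.
Qed.

(** Since [B] and [U] are homogeneous, the degree [d] component of any lift is again a lift. *)
Lemma mx_homog_lift d e m n r (U : 'M[Pol k]_(m, r)) (B : 'M_(n, r)) :
  mx_homog (d + e) U -> mx_homog e B ->
  (forall i, exists w : 'rV_n, row i U = w *m B) ->
  {W : 'M_(m, n) | mx_homog d W & W *m B = U}.
Proof.
move=> hU hB liftU.
(* Equality of row vectors is decidable, so [sigW] extracts an actual witness from the mere
   existence of a lift. *)
have row_lift i : {w : 'rV[Pol k]_n | row i U = w *m B}.
  by have [w /eqP] := sigW (P := fun w => row i U == w *m B)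
    (let: ex_intro w hw := liftU i in ex_intro _ w (introT eqP hw)); exists w.
pose W := \matrix_i map_mx (pihomog mdeg d) (sval (row_lift i)).
exists W; first by apply/mx_homogP => i j; rewrite !mxE; apply: pihomogP.
apply/matrixP => i j; case def_w: (row_lift i) => [w hw].
have /rowP/(_ j) := hw; rewrite mxE => Uij.
have /mx_homogP/(_ i j)/pihomog_dE <- := hU; rewrite Uij !mxE raddf_sum /=.
apply: eq_bigr => l _; rewrite pihomogM; last by have /mx_homogP := hB; apply.
by rewrite !mxE def_w.
Qed.

End HomogeneousLift.

(** * Mapping cones of pure resolutions *)

Section MappingCone.
Variable k : fieldType.

(** Twisted by [D 0] and shifted by one homological step, the resolution of [Q] resolves the
    relations between [f] and [I]. The condition on [D] and [D'] puts both summands of each module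
    of the cone in the same degree. *)
Lemma mapping_cone (D D' : nat -> nat) (I Q J : Pol k -> Prop) (f : Pol k) :
  pure_res D I -> pure_res D' Q -> (forall i, D i.+1 = D 0 + D' i)%N ->
  is_homog k (D 0) f -> (forall r, Q r <-> I (r * f)) ->
  (forall p, J p <-> exists q r, I q /\ p = q + r * f) -> pure_res D J.
Proof.
case=> b [G [M [incD [hG [hM [genI [ex0 [exS [n fin]]]]]]]]].
case=> b' [G' [M' [incD' [hG' [hM' [genQ [ex0' [exS' [n' fin']]]]]]]]].
move=> shiftD hf colon genJ.
pose delta i := (D i.+1 - D i)%N.
pose kk i := if i is j.+1 then b' j else 1%N.
(* [K] and [N] are the augmented complexes, with [R] in position 0 and the generators as first map,
   so that exactness reads the same for every [i]. *)
pose K i : 'M[Pol k]_(kk i.+1, kk i) :=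
  match i return 'M[Pol k]_(kk i.+1, kk i) with 0 => G' | j.+1 => M' j end.
pose bb i := if i is j.+1 then b j else 1%N.
pose N i : 'M[Pol k]_(bb i.+1, bb i) :=
  match i return 'M[Pol k]_(bb i.+1, bb i) with 0 => G | j.+1 => M j end.
have hK i : mx_homog (delta i) (K i).
  rewrite /delta; apply/mx_homogP; case: i => [|i] r c; rewrite !shiftD.
    by rewrite (ord1 c) addKn; apply: hG'.
  by rewrite subnDl; apply: hM'.
have hNS i : mx_homog (delta i) (N i.+1) by apply/mx_homogP => r c; apply: hM.
have hN0 : mx_homog (D 0%N) (N 0%N).
  by apply/mx_homogP => r c; rewrite (ord1 c); apply: hG.
have exN i (v : 'rV_(bb i.+1)) : v *m N i = 0 <-> exists w, v = w *m N i.+1.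
  by case: i v => [|i] v; [apply: ex0 | apply: exS].
have exK i (v : 'rV_(kk i.+1)) : v *m K i = 0 <-> exists w, v = w *m K i.+1.
  by case: i v => [|i] v; [apply: ex0' | apply: exS'].
have row_ext m c (A B : 'M[Pol k]_(m, c)) : (forall i, row i A = row i B) -> A = B.
  by move=> h; apply/row_matrixP.
have KK i : K i.+1 *m K i = 0.
  by apply: row_ext => r; rewrite row_mul row0; apply/exK; exists (delta_mx 0 r); rewrite -rowE.
have NN i : N i.+1 *m N i = 0.
  by apply: row_ext => r; rewrite row_mul row0; apply/exN; exists (delta_mx 0 r); rewrite -rowE.
(* The invariant of the comparison map: the vanishing product is what allows the next lift. The
   minus sign in [step] makes consecutive [Phi] compose to zero. *)
pose P i (T : 'M_(kk i.+1, b i)) :=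
  mx_homog (delta i) T && (K i.+1 *m T *m N i == 0).
have step i (T : {T | P i T}) :
  {T' | P i.+1 T' & T' *m N i.+1 = - (K i.+1 *m sval T)}.
  case: T => T /= /andP[hT /eqP KTN].
  have [||r|T' hT' defT'] := @mx_homog_lift k (delta i.+1) (delta i) _ _ _
    (- (K i.+1 *m T)) (N i.+1).
  - by apply/mx_homogN/mx_homogM.
  - exact: hNS.
  - by apply/exN; rewrite -row_mul mulNmx KTN oppr0 row0.
  by exists T' => //; apply/andP; split=> //; rewrite -mulmxA defT' mulmxN mulmxA KK mul0mx oppr0.
have [T0 PT0 defT0] : {T | P 0%N T & T *m N 0%N = - (f *: K 0%N)}.
  have [||r|T hT defT] := @mx_homog_lift k (delta 0%N) (D 0%N) _ _ _
    (- (f *: K 0%N)) (N 0%N).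
  - apply/mx_homogN/mx_homogP => i j; rewrite mxE /is_homog addnC.
    by apply: dhomogM => //; have /mx_homogP := hK 0%N; apply.
  - exact: hN0.
  - have [|v def_v] := proj1 (genI (- (f * G' r 0))).
      rewrite mulrC -mulNr; apply/colon/genQ; exists (- delta_mx 0 r).
      by rewrite mulNmx -rowE !mxE.
    by exists v; apply/rowP => j; rewrite (ord1 j) -def_v !mxE.
  exists T => //; apply/andP; split=> //.
  by rewrite -mulmxA defT mulmxN -scalemxAr KK scaler0 oppr0.
pose T : forall i, {T | P i T} := nat_rect (fun i => {T | P i T}) (exist _ T0 PT0)
  (fun i T => exist _ (s2val (step i T)) (s2valP (step i T))).
have defT i : sval (T i.+1) *m N i.+1 = - (K i.+1 *m sval (T i)).
  exact: (s2valP' (step i (T i))).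
pose c i := (b i + kk i)%N.
pose Phi i : 'M[Pol k]_(c i.+1, c i) := block_mx (M i) 0 (sval (T i)) (K i).
have PhiE i (v1 : 'rV_(b i.+1)) (v2 : 'rV_(kk i.+1)) :
  row_mx v1 v2 *m Phi i = row_mx (v1 *m M i + v2 *m sval (T i)) (v2 *m K i).
  by rewrite mul_row_block mulmx0 add0r.
exists c, (col_mx G f%:M), Phi; do !split.
- exact: incD.
- move=> j; rewrite -(splitK j); case: (split j) => l /=; rewrite ?col_mxEu ?col_mxEd //.
  by rewrite (ord1 l) mxE eqxx.
- move=> i r s; suff /mx_homogP: mx_homog (delta i) (Phi i) by apply.
  apply/mx_homogP => {}r {}s; rewrite -(splitK r) -(splitK s).
  case: (split r) => x; case: (split s) => y /=.
  + by rewrite block_mxEul; apply: hM.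
  + by rewrite block_mxEur mxE; apply: dhomog0.
  + by rewrite block_mxEdl; case: (T i) => t /= /andP[/mx_homogP].
  + by rewrite block_mxEdr; have /mx_homogP := hK i; apply.
- move/genJ => [q [r [/genI[v ->] ->]]]; exists (row_mx v r%:M).
  by rewrite mul_row_col -scalar_mxM !mxE eqxx.
- case=> v ->; apply/genJ; rewrite -(hsubmxK v) mul_row_col.
  exists ((lsubmx v *m G) 0 0), (rsubmx v 0 0); split; first by apply/genI; exists (lsubmx v).
  by rewrite mxE mul_mx_scalar [X in _ + X]mxE mulrC.
- rewrite -(hsubmxK v) mul_row_col mul_mx_scalar.
  set v1 := lsubmx v; set v2 := rsubmx v => eq0.
  have /genQ [w2 def_w2] : Q (v2 0 0).
    apply/colon/genI; exists (- v1); rewrite mulNmx.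
    by move/eqP: eq0; rewrite addr_eq0 => /eqP ->; rewrite opprK [RHS]mxE mulrC.
  have def_v2 : v2 = w2 *m K 0%N by apply/rowP => j; rewrite (ord1 j).
  have [w1 def_w1] : exists w, v1 - w2 *m sval (T 0%N) = w *m M 0%N.
    apply/ex0; rewrite mulmxBl -mulmxA defT0 mulmxN -scalemxAr opprK.
    by rewrite -def_v2.
  by exists (row_mx w1 w2); rewrite PhiE -def_w1 subrK def_v2.
- case=> w ->; rewrite -(hsubmxK w) PhiE mul_row_col mul_mx_scalar mulmxDl -!mulmxA.
  have -> : M 0%N *m G = 0 by exact: NN 0%N.
  by rewrite defT0 mulmx0 add0r mulmxN -scalemxAr addNr.
- rewrite -(hsubmxK v) PhiE -(row_mx0 _ _ (b i)).
  set v1 := lsubmx v; set v2 := rsubmx v => /eq_row_mx [eq1 /exK[w2 def_v2]].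
  have [w1 def_w1] : exists w, v1 - w2 *m sval (T i.+1) = w *m M i.+1.
    apply/exS; rewrite mulmxBl -mulmxA; have -> := defT i.
    by rewrite mulmxN opprK mulmxA -def_v2.
  by exists (row_mx w1 w2); rewrite PhiE -def_w1 subrK def_v2.
- case=> w ->; rewrite -(hsubmxK w) !PhiE -(row_mx0 _ _ (b i)); congr row_mx.
    rewrite mulmxDl -!mulmxA; have -> := NN i.+1; have -> := defT i.
    by rewrite mulmx0 add0r mulmxN addNr.
  by rewrite -mulmxA KK mulmx0.
exists (maxn n n').+1 => -[|i]; rewrite // ltnS gtn_max => /andP[lt_n lt_n'].
by rewrite /c /kk fin ?fin' // ltnS ltnW.
Qed.

End MappingCone.

(** * Monomial ideals and linear quotients *)

Section MonomialIdeals.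
Variable k : fieldType.
Implicit Types (P : pred 'X_{1..4}) (p q r : Pol k) (m u v w : 'X_{1..4}) (s t : seq 'X_{1..4}).

(** Membership is a boolean test on the support. Closure of [P] under multiples is a hypothesis of
    the lemmas that use it. *)
Definition mon_ideal P p := all P (msupp p).

Definition mdvd s m := has (fun u => (u <= m)%MM) s.

Lemma mon_idealP P p : reflect (forall m, p@_m != 0 -> P m) (mon_ideal P p).
Proof. by apply: (iffP allP) => h m => [|] hm; apply: h; move: hm; rewrite mcoeff_msupp. Qed.

Lemma mon_idealX P m : mon_ideal P 'X_[m] = P m.
Proof. by rewrite /mon_ideal msuppX /= andbT. Qed.

Lemma mon_ideal0 P : mon_ideal P 0.
Proof. by apply/mon_idealP => m; rewrite mcoeff0 eqxx. Qed.

Lemma mon_idealD P p q : mon_ideal P p -> mon_ideal P q -> mon_ideal P (p + q).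
Proof.
move=> /allP hp /allP hq; apply/allP => m /msuppD_le.
by rewrite mem_cat => /orP[/hp|/hq].
Qed.

Lemma mon_idealZ P (c : k) p : mon_ideal P p -> mon_ideal P (c *: p).
Proof. by move=> /allP hp; apply/allP => m /msuppZ_le /hp. Qed.

Lemma mon_ideal_sum P (I : Type) (l : seq I) (E : pred I) (F : I -> Pol k) :
  (forall i, E i -> mon_ideal P (F i)) -> mon_ideal P (\sum_(i <- l | E i) F i).
Proof.
by move=> h; elim/big_rec: _ => [|i x Ei hx]; [apply: mon_ideal0 | apply/mon_idealD/hx/h].
Qed.

Lemma mon_idealM P1 P2 P p q : (forall m u, P1 m -> P2 u -> P (m + u)%MM) ->
  mon_ideal P1 p -> mon_ideal P2 q -> mon_ideal P (p * q).
Proof.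
move=> hP /allP hp /allP hq; apply/allP => m /msuppM_le /allpairsP[[m1 m2] /= [h1 h2 ->]].
by apply: hP; [apply: hp | apply: hq].
Qed.

Lemma mon_idealT p : mon_ideal predT p. Proof. exact/allP. Qed.

Lemma mon_ideal_colon P r u :
  mon_ideal P (r * 'X_[u]) = mon_ideal (fun m => P (m + u)%MM) r.
Proof.
rewrite /mon_ideal (perm_all _ (msuppMX _ _)) all_map; apply: eq_all => m /=.
by rewrite addmC.
Qed.

Lemma eq_mon_ideal P1 P2 : P1 =1 P2 -> mon_ideal P1 =1 mon_ideal P2.
Proof. by move=> h p; apply: eq_all. Qed.

Lemma mdvd_cons u s m : mdvd (u :: s) m = (u <= m)%MM || mdvd s m.
Proof. by []. Qed.

Lemma mdvdP s m : reflect (exists2 u, u \in s & (u <= m)%MM) (mdvd s m).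
Proof. exact: hasP. Qed.

Lemma mdvdD s m u : mdvd s m -> mdvd s (m + u)%MM.
Proof. by case/mdvdP => w ws le_wm; apply/mdvdP; exists w; rewrite ?(lepm_trans le_wm) ?lem_addr. Qed.

Lemma eq_pure_res (D : nat -> nat) (I J : Pol k -> Prop) :
  (forall p, I p <-> J p) -> pure_res D I -> pure_res D J.
Proof.
move=> eqIJ [b [G [M [? [? [? [genI ?]]]]]]]; exists b, G, M; do !split => //.
  by move/eqIJ/genI.
by move/genI/eqIJ.
Qed.

Lemma pure_res_nil (D : nat -> nat) : (forall i, D i < D i.+1)%N ->
  pure_res D (mon_ideal (mdvd [::]) : Pol k -> Prop).
Proof.
move=> incD; exists (fun=> 0%N), 0, (fun=> 0).
have mx0 n (v : 'M[Pol k]_(n, 0)) : v = 0 by apply/matrixP => ? [].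
do !split => //.
- by case.
- by move=> ? [].
- move=> /mon_idealP h; exists 0; rewrite mul0mx mxE; apply/mpolyP => m; rewrite mcoeff0.
  by apply/eqP; case: eqP => // /eqP /h.
- by case=> v ->; rewrite mulmx0 mxE mon_ideal0.
- by exists 0; rewrite (mx0 _ v) mul0mx.
- by case=> w _; rewrite /= mulmx0.
- by exists 0; rewrite (mx0 _ v) mul0mx.
by exists 0%N.
Qed.

Lemma pure_res_cons (D D' : nat -> nat) u s t :
  pure_res D (mon_ideal (mdvd s) : Pol k -> Prop) ->
  pure_res D' (mon_ideal (mdvd t) : Pol k -> Prop) ->
  (forall i, D i.+1 = D 0 + D' i)%N -> mdeg u = D 0 ->
  (forall m, mdvd s (m + u)%MM = mdvd t m) ->
  pure_res D (mon_ideal (mdvd (u :: s)) : Pol k -> Prop).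
Proof.
move=> resI resQ shiftD deg_u colon.
apply: (mapping_cone (f := 'X_[u]) resI resQ shiftD).
- by rewrite /is_homog dhomogX; apply/eqP.
- by move=> r; rewrite mon_ideal_colon (eq_mon_ideal colon).
move=> p; split=> [/allP hp|[q [r [hq ->]]]].
  (* The terms of [p] divisible by a member of [s] are split off; all remaining terms are divisible
     by [u]. *)
  exists (\sum_(m <- msupp p | mdvd s m) p@_m *: 'X_[m]).
  exists (\sum_(m <- msupp p | ~~ mdvd s m) p@_m *: 'X_[m - u]); split.
    by apply: mon_ideal_sum => m hm; rewrite mon_idealZ ?mon_idealX.
  rewrite {1}[p]mpolyE (bigID (mdvd s)) /=; congr (_ + _).
  rewrite mulr_suml big_seq_cond [RHS]big_seq_cond; apply: eq_bigr => m /andP[/hp].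
  by rewrite mdvd_cons => /orP[um _|->//]; rewrite -scalerAl -mpolyXD submK.
apply: mon_idealD.
  by apply: sub_all hq => m; rewrite mdvd_cons => ->; rewrite orbT.
by rewrite mon_ideal_colon; apply/allP => m _; rewrite mdvd_cons lem_addl.
Qed.

(** This is the Koszul complex as an iterated cone: a new variable is a nonzerodivisor modulo the
    others, so the colon ideal is the ideal itself. *)
Lemma pure_res_vars (V : seq 'I_4) : uniq V ->
  pure_res S (mon_ideal (mdvd [seq U_(i)%MM | i <- V]) : Pol k -> Prop).
Proof.
elim: V => [_|i V IH /= /andP[iV uV]]; first exact: pure_res_nil.
apply: (pure_res_cons (IH uV) (IH uV)); rewrite ?mdeg1 // => m.
rewrite /mdvd !has_map; apply: eq_in_has => j jV /=; rewrite !lep1mP mnmDE mnm1E.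
by case: (eqVneq i j) iV => [->|_ _]; rewrite ?jV ?addn0.
Qed.

(** Here [x] divides [v / gcd(u, v)] and [x u] is a multiple of an earlier generator [w], so each
    colon ideal is generated by variables. Strictness for [w] makes ties of [key] harmless: [w]
    precedes [u] however ties are sorted. *)
Lemma pure_res_linear_quotients (disp : Order.disp_t) (T : orderType disp)
    (key : 'X_{1..4} -> T) (d : nat) s :
  uniq s -> {in s, forall u, mdeg u = d} ->
  {in s &, forall u v, u != v -> (key v <= key u)%O ->
     exists2 x, (u x < v x)%N &
     exists w, [/\ w \in s, (key w < key u)%O & (w <= u + U_(x))%MM]} ->
  pure_res (addn d) (mon_ideal (mdvd s) : Pol k -> Prop).
Proof.
move=> uniq_s deg_s lq.
(* The sort is decreasing because the head of the list is the generator adjoined last. *)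
pose ge u v := (key v <= key u)%O.
have ge_trans : transitive ge by move=> v u w uv vw; apply: le_trans vw uv.
have ge_total : total ge by move=> u v; apply: le_total.
apply: (@eq_pure_res _ (mon_ideal (mdvd (sort ge s)))).
  by move=> p; rewrite (@eq_mon_ideal _ (mdvd s)) // => m; apply: eq_has_r => u; rewrite mem_sort.
have : sorted ge (sort ge s) by apply: sort_sorted.
have {uniq_s} : uniq (sort ge s) by rewrite sort_uniq.
have {deg_s} : {in sort ge s, forall u, mdeg u = d} by move=> u; rewrite mem_sort; apply: deg_s.
have {lq} : {in sort ge s &, forall u v, u != v -> (key v <= key u)%O ->
     exists2 x, (u x < v x)%N &
     exists w, [/\ w \in sort ge s, (key w < key u)%O & (w <= u + U_(x))%MM]}.
  move=> u v; rewrite !mem_sort => us vs uv le_vu; have [x ltx [w hw]] := lq u v us vs uv le_vu.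
  by exists x => //; exists w; rewrite mem_sort.
elim: (sort ge s) => [|u {}s IH] lq deg_s /=; first by move=> *; apply: pure_res_nil => i; rewrite addnS.
case/andP=> us uniq_s sort_us.
have le_u : {in s, forall v, (key v <= key u)%O}.
  by apply/allP; apply: order_path_min sort_us.
have lt_s u' w : u' \in u :: s -> w \in u :: s -> (key w < key u')%O -> w \in s.
  rewrite !inE => /predU1P u's /predU1P[->|//]; rewrite ltNge.
  by case: u's => [->|/le_u ->//]; rewrite lexx.
pose V := [seq x <- enum 'I_4 | mdvd s (u + U_(x))%MM].
have resV : pure_res S (mon_ideal (mdvd [seq U_(i)%MM | i <- V]) : Pol k -> Prop).
  by apply: pure_res_vars; rewrite filter_uniq ?enum_uniq.
apply: pure_res_cons resV _ _ _.
- apply: IH => //; last exact: path_sorted sort_us.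
    move=> u' v u's vs uv le_vu.
    have [||x ltx [w [hw lt_w le_w]]] := lq u' v _ _ uv le_vu; rewrite ?inE ?u's ?vs ?orbT //.
    by exists x => //; exists w; split=> //; apply: lt_s hw lt_w; rewrite inE u's orbT.
  by move=> v vs; apply: deg_s; rewrite inE vs orbT.
- by move=> i; rewrite addn0.
- by rewrite addn0; apply: deg_s; rewrite mem_head.
move=> m; apply/mdvdP/mdvdP => [[v vs le_v]|[v /mapP[x]]].
  have [||||x ltx [w [hw lt_w le_w]]] := lq u v.
  - exact: mem_head.
  - by rewrite inE vs orbT.
  - by apply: contraNneq us => ->.
  - exact: le_u.
  exists U_(x)%MM; last first.
    by rewrite lep1mP -lt0n; move/mnm_lepP/(_ x): le_v; rewrite mnmDE; lia.
  apply/map_f; rewrite mem_filter mem_enum andbT; apply/mdvdP; exists w => //.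
  by apply: lt_s hw lt_w; apply: mem_head.
rewrite mem_filter => /andP[/mdvdP[w ws le_w] _] ->{v} le_x; exists w => //.
by apply: lepm_trans le_w _; apply/mnm_lepP => i; move/mnm_lepP/(_ i): le_x; rewrite !mnmDE; lia.
Qed.

End MonomialIdeals.

(** * Tetrahedral ideals and their graded components as monomial ideals *)

Section IdealSpans.
Variable k : fieldType.
Implicit Types (P : pred 'X_{1..4}) (S : Pol k -> Prop) (p q : Pol k) (m u : 'X_{1..4}).

Lemma ideal_span_id S p : S p -> ideal_span k S p.
Proof. by exists 1%N, (fun=> 1), (fun=> p); rewrite big_ord1 mul1r. Qed.

(** [g] selects, for each monomial of [p], a monomial of [S] dividing it. *)
Lemma ideal_span_mon S (g : 'X_{1..4} -> 'X_{1..4}) p :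
  {in msupp p, forall m, S 'X_[g m] /\ (g m <= m)%MM} -> ideal_span k S p.
Proof.
move=> hg; pose m (j : 'I_(size (msupp p))) := tnth (in_tuple (msupp p)) j.
have hm j : m j \in msupp p by apply: mem_tnth.
exists (size (msupp p)), (fun j => p@_(m j) *: 'X_[m j - g (m j)]), (fun j => 'X_[g (m j)]).
split=> [j|]; first by have [] := hg _ (hm j).
rewrite {1}[p]mpolyE big_tnth; apply: eq_bigr => j _.
by rewrite -scalerAl -mpolyXD submK //; have [] := hg _ (hm j).
Qed.

Lemma ideal_span_sub_mon S P p : (forall m u, P u -> P (m + u)%MM) ->
  (forall q, S q -> mon_ideal P q) -> ideal_span k S p -> mon_ideal P p.
Proof.
move=> hP hS [n [r [s [hs ->]]]]; apply: mon_ideal_sum => j _.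
by apply: (mon_idealM (P1 := predT) (P2 := P)) => [m u _| |]; [apply: hP|apply: mon_idealT|apply: hS].
Qed.

Lemma ideal_pow_var (i j n : nat) p : inord i != inord j :> 'I_4 ->
  ideal_pow k (var_ideal k i j) n p <->
  mon_ideal (fun m => n <= m (inord i) + m (inord j))%N p.
Proof.
move=> ij; elim: n p => [|n IH] p /=; first by split=> // _; apply: mon_idealT.
split.
  apply: ideal_span_sub_mon => [m u|_ [f [g [/IH hf [hg ->]]]]]; first by rewrite !mnmDE; lia.
  have {}hg : mon_ideal (fun m => 0 < m (inord i) + m (inord j))%N g.
    apply: ideal_span_sub_mon hg => [m u|_ [->|->]]; rewrite ?mnmDE; first lia.
      by rewrite mon_idealX !mnm1E eqxx.
    by rewrite mon_idealX !mnm1E eqxx addn1.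
  by apply: mon_idealM hf hg => m u; rewrite !mnmDE; lia.
move=> /allP hp; apply: (ideal_span_mon (g := id)) => m /hp hm; split; last exact: lepm_refl.
(* A variable of positive exponent is divided out to descend from [n.+1] to [n]. *)
have [l hl lE] : exists2 l, (0 < m l)%N & l = inord i \/ l = inord j.
  by have [/eqP mi0|] := posnP (m (inord i)); [exists (inord j); auto; lia | exists (inord i); auto].
exists 'X_[m - U_(l)], 'X_l; split; last split.
- apply/IH; rewrite mon_idealX !mnmBE !mnm1E.
  by case: lE hl => ->; rewrite eqxx ?(negPf ij) 1?eq_sym ?(negPf ij); lia.
- by apply: ideal_span_id; case: lE => ->; [left|right].
by rewrite -mpolyXD submK // lep1mP -lt0n.
Qed.

Definition tet_mon (C : tcurve) m :=
  [&& a1 C <= m (inord 0) + m (inord 1), a2 C <= m (inord 0) + m (inord 2),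
      a3 C <= m (inord 0) + m (inord 3), a4 C <= m (inord 1) + m (inord 2),
      a5 C <= m (inord 1) + m (inord 3) & a6 C <= m (inord 2) + m (inord 3)]%N.

Lemma tet_monD C m u : tet_mon C u -> tet_mon C (m + u)%MM.
Proof. by rewrite /tet_mon !mnmDE; lia. Qed.

Lemma tet_idealE C p : tet_ideal k C p <-> mon_ideal (tet_mon C) p.
Proof.
rewrite /tet_ideal !ideal_pow_var -?val_eqE /= ?inordK //.
by rewrite /mon_ideal /tet_mon !all_predI; split=> [[-> [-> [-> [-> [-> ->]]]]]|/and5P[? ? ? ? /andP[]]].
Qed.

(** Monomials of bounded degree form a finite type, so those of degree [d] in [P] can be
    enumerated. *)
Definition deg_mons P (d : nat) : seq 'X_{1..4} :=
  [seq bmnm m | m : 'X_{1..4 < d.+1} <- enum {: 'X_{1..4 < d.+1}} & (mdeg m == d) && P m].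

Lemma mem_deg_mons P d u : (u \in deg_mons P d) = (mdeg u == d) && P u.
Proof.
apply/mapP/idP => [[m] | /andP[/eqP deg_u Pu]]; first by rewrite mem_filter => /andP[hm _] ->.
have ltu : (mdeg u < d.+1)%N by rewrite deg_u.
by exists (BMultinom ltu); rewrite // mem_filter mem_enum /= deg_u eqxx Pu.
Qed.

Lemma deg_mons_uniq P d : uniq (deg_mons P d).
Proof. by rewrite map_inj_uniq ?filter_uniq -?enumT ?enum_uniq // => u v /val_inj. Qed.

Lemma ideal_componentE P d p : (forall m u, P u -> P (m + u)%MM) ->
  ideal_span k (fun q => mon_ideal P q /\ is_homog k d q) p <->
  mon_ideal (mdvd (deg_mons P d)) p.
Proof.
move=> hP; split.
  apply: ideal_span_sub_mon => [m u|q [/allP Pq /dhomogP hq]].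
    by rewrite addmC; apply: mdvdD.
  apply/allP => m hm; apply/mdvdP; exists m; rewrite ?lepm_refl // mem_deg_mons.
  by rewrite Pq // andbT; apply/eqP/hq.
move=> /allP hp.
pose g m := nth m (deg_mons P d) (find (fun u => (u <= m)%MM) (deg_mons P d)).
apply: (ideal_span_mon (g := g)) => m /hp hm; split; last exact: (nth_find m hm).
have : g m \in deg_mons P d by apply: mem_nth; rewrite -has_find.
rewrite mem_deg_mons => /andP[/eqP hd Pg]; rewrite mon_idealX; split=> //.
by rewrite /is_homog dhomogX; apply/eqP.
Qed.

End IdealSpans.

Ltac split_lia := repeat first [apply/andP; split | apply/implyP => ?]; lia.

(** * Relabelling the four variables *)

Section Relabelling.
Variables x0 x1 x2 x3 : 'I_4.
Hypothesis uniq_x : uniq [:: x0; x1; x2; x3].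
Implicit Types u v m : 'X_{1..4}.

Lemma mem_labels i : i \in [:: x0; x1; x2; x3].
Proof.
have eq_card : #|[:: x0; x1; x2; x3]| = #|{: 'I_4}|.
  by rewrite card_ord (card_uniqP uniq_x).
by rewrite (elimT (subset_cardP eq_card)) //; apply/subsetP.
Qed.

Lemma mdeg_labels m : mdeg m = (m x0 + m x1 + m x2 + m x3)%N.
Proof.
rewrite mdegE (perm_big [:: x0; x1; x2; x3]) /=.
  by rewrite !big_cons big_nil addn0 !addnA.
by apply: uniq_perm; rewrite ?index_enum_uniq // => i; rewrite mem_index_enum mem_labels.
Qed.

Lemma mnm_labelsP u v :
  u x0 = v x0 -> u x1 = v x1 -> u x2 = v x2 -> u x3 = v x3 -> u = v.
Proof.
by move=> h0 h1 h2 h3; apply/mnmP => i; have := mem_labels i; rewrite !inE => /or4P[] /eqP ->.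
Qed.

Lemma neq_labels :
  ((x0 == x1) = false) * ((x1 == x0) = false) * ((x0 == x2) = false) *
  ((x2 == x0) = false) * ((x0 == x3) = false) * ((x3 == x0) = false) *
  ((x1 == x2) = false) * ((x2 == x1) = false) * ((x1 == x3) = false) *
  ((x3 == x1) = false) * ((x2 == x3) = false) * ((x3 == x2) = false).
Proof.
move: uniq_x; rewrite /= !inE !negb_or => /and4P[/and3P[] a b c /andP[d e] f _].
by do !split; apply: negbTE => //; rewrite eq_sym.
Qed.

(** * Linear quotients for minimal curves *)

Section MinimalCurve.
Variables p q b02 b03 b12 b13 : nat.
Hypotheses (hp0 : (b02 + b12 < p)%N) (hp1 : (b03 + b13 < p)%N).
Hypotheses (hq0 : (b02 + b03 < q)%N) (hq1 : (b12 + b13 < q)%N).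

(** [p] and [q] belong to opposite edges. Each of the four strict inequalities assumed above blocks
    the reduction at one facet. *)
Definition min_mon m :=
  [&& p <= m x0 + m x1, q <= m x2 + m x3, b02 <= m x0 + m x2,
      b03 <= m x0 + m x3, b12 <= m x1 + m x2 & b13 <= m x1 + m x3]%N.

(** The third entry is the distance from [m x2] to [b02], as a sum of two truncated differences. *)
Definition min_key m : seqlexi nat :=
  [:: (m x0 + m x1)%N; m x0; ((m x2 - b02) + (b02 - m x2))%N].

Lemma min_mon_lq d : {in deg_mons min_mon d &, forall u v, u != v ->
  (min_key v <= min_key u)%O ->
     exists2 x, (u x < v x)%N &
     exists w, [/\ w \in deg_mons min_mon d, (min_key w < min_key u)%O &
                   (w <= u + U_(x))%MM]}.
Proof.
move=> u v; rewrite !mem_deg_mons !mdeg_labels => /andP[/eqP du Pu] /andP[/eqP dv Pv] uv.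
have {uv} uv : [|| u x0 != v x0, u x1 != v x1, u x2 != v x2 | u x3 != v x3]%N.
  apply: contraR uv; rewrite !negb_or !negbK => /and4P[] /eqP ? /eqP ? /eqP ? /eqP ?.
  exact/eqP/mnm_labelsP.
rewrite !lexi_cons lexi0s !leEnat => le_vu.
(* The witness is [w = u x / y]. Of the seven exchanges listed, four lower the degree in [x0, x1],
   one lowers that in [x0] alone, and two move the degree in [x2]. *)
pose good x y := let w := (u + U_(x) - U_(y))%MM in
  [&& u x < v x, 0 < u y & min_mon w]%N && (min_key w < min_key u)%O.
suff /hasP[[x y] _ /andP[/and3P[ltx uy Pw] ltw]] : has (fun xy => good xy.1 xy.2)
    [:: (x2, x0); (x2, x1); (x3, x0); (x3, x1); (x1, x0); (x2, x3); (x3, x2)].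
  exists x => //; exists (u + U_(x) - U_(y))%MM; split=> //; last exact: lem_subr.
  have le_y : (U_(y) <= u + U_(x))%MM by rewrite lep1mP mnmDE -lt0n addn_gt0 uy.
  rewrite mem_deg_mons Pw andbT; have := mdegD (u + U_(x) - U_(y)) U_(y).
  by rewrite submK // mdegD !mdeg1 (mdeg_labels u) du => /addIn <-.
rewrite /= /good /= /min_mon /min_key !ltxi_cons !ltxi0s eqxx !implybF !leEnat /=.
rewrite !mnmBE !mnmDE !mnm1E !eqxx !neq_labels.
move: Pu Pv; rewrite /min_mon.
move: uv le_vu du dv; move: (u x0) (u x1) (u x2) (u x3) (v x0) (v x1) (v x2) (v x3).
move=> u0 u1 u2 u3 v0 v1 v2 v3 /= uv /andP[le01 le_vu] du dv.
move=> /and5P[u01 u23 u02 u03 /andP[u12 u13]] /and5P[v01 v23 v02 v03 /andP[v12 v13]].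
have [lt01|ge01] := ltnP (v0 + v1) (u0 + u1).
  clear uv le_vu.
  (* As [x2] grows, only the edges at [x3] can obstruct. If neither [x0] nor [x1] could be lowered,
     then [u0 + u1 <= b03 + b13 < p]. The case of [x3] is symmetric. *)
  have [lt2|le2] := ltnP u2 v2.
    have [/and3P[? ? ?]|n0] := boolP [&& 0 < u0, b02 < u0 + u2 + 1 & b03 < u0 + u3]%N.
      by apply/orP; left; split_lia.
    by apply/orP; right; apply/orP; left; split_lia.
  have [/and3P[? ? ?]|n0] := boolP [&& 0 < u0, b02 < u0 + u2 & b03 < u0 + u3 + 1]%N.
    by do 2! [apply/orP; right]; apply/orP; left; split_lia.
  by do 3! [apply/orP; right]; apply/orP; left; split_lia.
do 4! [apply/orP; right].
move: le_vu; rewrite ge01 /= => /andP[le0 le_vu].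
have [lt0|ge0] := ltnP v0 u0.
  clear uv le_vu.
  (* In the cases [e2] and [e3] an edge at [x0] is tight. Then [u2 < b02], respectively [u2 > b02]
     because [b02 + b03 < q], and moving [u2] towards [b02] lowers the key. *)
  have [e2|ne2] := eqVneq (u0 + u2)%N b02.
    by apply/orP; right; apply/orP; left; split_lia.
  have [e3|ne3] := eqVneq (u0 + u3)%N b03.
    by do 2! [apply/orP; right]; apply/orP; left; split_lia.
  by apply/orP; left; split_lia.
move: le_vu; rewrite ge0 /= => le_vu.
(* Now [u] and [v] agree at [x0] and [x1]. As [v2] is no farther from [b02] than [u2], moving [u2]
   towards [b02] also moves it towards [v2]. *)
have {}uv : u2 != v2 by lia.
have [lt2|le2] := ltnP u2 b02.
  by apply/orP; right; apply/orP; left; split_lia.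
by do 2! [apply/orP; right]; apply/orP; left; split_lia.
Qed.

(** Generation in the single degree [p + q]: above that degree one of the two opposite edges is
    slack, and the strict inequalities let one of its two variables be divided out. *)
Lemma min_mon_gen m : min_mon m = mdvd (deg_mons min_mon (p + q)) m.
Proof.
apply/idP/mdvdP => [|[u]]; last first.
  rewrite mem_deg_mons => /andP[_ Pu] /mnm_lepP le_um.
  have := (le_um x0, le_um x1, le_um x2, le_um x3); move: Pu; rewrite /min_mon => Pu [[[]]].
  by lia.
have [n] := ubnP (mdeg m); elim: n m => // n IH m lt_n Pm.
have [eq_deg|ne_deg] := eqVneq (mdeg m) (p + q)%N.
  by exists m; rewrite ?lepm_refl // mem_deg_mons eq_deg eqxx.
suff [y my Py] : exists2 y, (0 < m y)%N & min_mon (m - U_(y))%MM.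
  have Uy : (U_(y) <= m)%MM by rewrite lep1mP -lt0n.
  have [|//|u hu le_u] := IH (m - U_(y))%MM; last first.
    by exists u => //; apply: lepm_trans le_u (lem_subr _ _).
  by have := mdegD (m - U_(y)) U_(y); rewrite submK // mdeg1; lia.
suff /hasP[y _ /andP[my Py]] : has (fun y => (0 < m y)%N && min_mon (m - U_(y))%MM)
   [:: x0; x1; x2; x3] by exists y.
rewrite /= /min_mon !mnmBE !mnm1E !eqxx !neq_labels.
move: Pm ne_deg; rewrite mdeg_labels /min_mon.
move: (m x0) (m x1) (m x2) (m x3) => m0 m1 m2 m3 /= Pm ne_deg.
have [lt01|le01] := ltnP p (m0 + m1).
  have [n0|n0] := boolP [&& 0 < m0, b02 < m0 + m2 & b03 < m0 + m3]%N.
    by apply/orP; left; lia.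
  by apply/orP; right; apply/orP; left; lia.
have [n2|n2] := boolP [&& 0 < m2, b02 < m0 + m2 & b12 < m1 + m2]%N.
  by do 2! [apply/orP; right]; apply/orP; left; lia.
by do 3! [apply/orP; right]; apply/orP; left; lia.
Qed.

End MinimalCurve.
End Relabelling.

(** * Special curves: a pure resolution that is not linear *)

Section SpecialCurve.
Variables (k : fieldType) (x0 x1 x2 x3 : 'I_4) (r : nat).
Hypothesis uniq_x : uniq [:: x0; x1; x2; x3].
Implicit Types (m u : 'X_{1..4}) (p : Pol k).

Definition spec_mon m :=
  [&& r <= m x0 + m x2, r <= m x0 + m x3, r <= m x1 + m x2 & r <= m x1 + m x3]%N.

Definition spec_gen i : 'X_{1..4} :=
  ((U_(x0) + U_(x1)) *+ i + (U_(x2) + U_(x3)) *+ (r - i))%MM.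

Lemma spec_genE i :
  (spec_gen i x0 = i) * (spec_gen i x1 = i) *
  (spec_gen i x2 = r - i)%N * (spec_gen i x3 = r - i)%N.
Proof.
by do !split; rewrite mnmDE !mulmnE !mnmDE !mnm1E eqxx !(neq_labels uniq_x); lia.
Qed.

Lemma mdeg_spec_gen i : (i <= r)%N -> mdeg (spec_gen i) = (2 * r)%N.
Proof. by rewrite (mdeg_labels uniq_x) !spec_genE; lia. Qed.

Lemma spec_mon_gen i : (i <= r)%N -> spec_mon (spec_gen i).
Proof. by rewrite /spec_mon !spec_genE; lia. Qed.

Lemma spec_gen_le i m :
  (spec_gen i <= m)%MM = [&& i <= m x0, i <= m x1, r - i <= m x2 & r - i <= m x3]%N.
Proof.
apply/mnm_lepP/and4P => [h|[h0 h1 h2 h3] j].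
  by split; [have := h x0|have := h x1|have := h x2|have := h x3]; rewrite spec_genE.
by have := mem_labels uniq_x j; rewrite !inE => /or4P[] /eqP ->; rewrite spec_genE.
Qed.

(** Reversed, so that the head is the generator adjoined last. *)
Definition spec_gens n := [seq spec_gen i | i <- rev (iota 0 n)].

Lemma mdvd_spec_gens n m :
  reflect (exists2 i, (i < n)%N & (spec_gen i <= m)%MM) (mdvd (spec_gens n) m).
Proof.
apply: (iffP (mdvdP _ _)) => [[_ /mapP[i hi ->]]|[i hi le_m]].
  by exists i; move: hi; rewrite // mem_rev mem_iota.
by exists (spec_gen i) => //; apply: map_f; rewrite mem_rev mem_iota.
Qed.

Lemma spec_monE m : spec_mon m = mdvd (spec_gens r.+1) m.
Proof.
apply/idP/mdvd_spec_gens => [|[i]]; rewrite /spec_mon.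
  (* The largest admissible [i]. If it equals [m x0] or [m x1], the two inequalities at that
     variable bound [m x2] and [m x3]. *)
  by move=> hm; exists (minn r (minn (m x0) (m x1))); rewrite ?spec_gen_le; lia.
by rewrite spec_gen_le; lia.
Qed.

Lemma spec_mon_deg m : spec_mon m -> (2 * r <= mdeg m)%N.
Proof. by rewrite (mdeg_labels uniq_x) /spec_mon; lia. Qed.

Lemma spec_mon_deg_gen m : spec_mon m -> mdeg m = (2 * r)%N ->
  m = spec_gen (m x0) /\ (m x0 <= r)%N.
Proof.
rewrite (mdeg_labels uniq_x) /spec_mon => hm deg_m; split; last by lia.
by apply: (mnm_labelsP uniq_x); rewrite spec_genE; lia.
Qed.

(* The colon ideal of the generators below [(x0 x1)^n (x2 x3)^(r-n)] is [(x2 x3)]: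
   this jump of two degrees is where the resolution fails to be linear. *)
Lemma spec_pure n : (n <= r.+1)%N ->
  pure_res (fun i => 2 * r + (i + (0 < i)))%N (mon_ideal (mdvd (spec_gens n)) : Pol k -> Prop).
Proof.
elim: n => [|n IH] lt_n; first by apply: pure_res_nil => -[|i] /=; lia.
pose y := (U_(x2) + U_(x3))%MM.
(* For [n = 0] there is no earlier generator and the colon ideal is zero, whence the empty list when
   [b] is false. *)
have resQ (b : bool) : pure_res (fun i => i.+2)
    (mon_ideal (mdvd (nseq b y)) : Pol k -> Prop).
  case: b; last exact: pure_res_nil.
  apply: (@pure_res_cons _ _ S _ _ [::]); try exact: pure_res_nil.
  - by move=> i; rewrite add2n.
  - by rewrite mdegD !mdeg1.
  - by [].
rewrite /spec_gens -[n.+1]addn1 iotaD rev_cat /=.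
apply: (pure_res_cons (IH (ltnW lt_n)) (resQ (0 < n)%N)).
- by case=> [|i] /=; lia.
- by rewrite mdeg_spec_gen // addn0.
move=> m; rewrite add0n; apply/mdvd_spec_gens/idP => [[i lt_i]|].
  rewrite spec_gen_le !(spec_genE, mnmDE) => hm.
  rewrite (leq_ltn_trans _ lt_i) //= /mdvd /= orbF; apply/mnm_lepP => j; rewrite mnmDE !mnm1E.
  have := mem_labels uniq_x j; rewrite !inE => /or4P[] /eqP ->; rewrite ?eqxx !(neq_labels uniq_x) //; lia.
case: n lt_n {IH} => // n lt_n; rewrite /mdvd /= orbF => /mnm_lepP le_m.
exists n => //; rewrite spec_gen_le !(spec_genE, mnmDE).
have := (le_m x2, le_m x3); rewrite !mnmDE !mnm1E !eqxx !(neq_labels uniq_x) => -[]; lia.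
Qed.

(** Two generators differ by the same nonzero amount in [x0] and in [x1]. Monomials of degree one
    cannot compensate both, so no terms cancel. *)
Lemma spec_gens_linearly_free (L : 'I_r.+1 -> Pol k) :
  (forall i, is_homog k 1 (L i)) -> \sum_i L i * 'X_[spec_gen i] = 0 ->
  forall i, L i = 0.
Proof.
move=> hL sum0 i; apply/mpolyP => m; rewrite mcoeff0.
have [deg_m|deg_m] := eqVneq (mdeg m) 1%N; last exact: (dhomog_nemf_coeff (hL i)).
have := congr1 (mcoeff (spec_gen i + m)%MM) sum0.
rewrite raddf_sum mcoeff0 (bigD1 i) //= mcoeffMX big1 ?addr0 // => j ne_ji.
apply: memN_msupp_eq0; rewrite (perm_mem (msuppMX _ _)); apply/mapP => -[u hu].
have /dhomogP/(_ u hu) deg_u := hL j.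
move/mnmP => eq_mu; have := (eq_mu x0, eq_mu x1); rewrite !(spec_genE, mnmDE) => -[].
move: deg_m deg_u ne_ji; rewrite -val_eqE /= !(mdeg_labels uniq_x); lia.
Qed.

Lemma spec_not_linear (J : Pol k -> Prop) : (0 < r)%N ->
  (forall p, J p <-> mon_ideal spec_mon p) -> ~ has_linear_res k J.
Proof.
move=> r_gt0 JE [d [b [G [M [_ [hG [hM [genJ [ex0 _]]]]]]]]].
have JG j : J (G j 0) by apply/genJ; exists (delta_mx 0 j); rewrite -rowE mxE.
have Jgen i : (i <= r)%N -> exists v : 'rV_(b 0), 'X_[spec_gen i] = (v *m G) 0 0.
  by move=> le_i; apply/genJ/JE; rewrite mon_idealX spec_mon_gen.
(* The ideal lives in degrees at least [2 * r], and [d] cannot exceed the degree of an element of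
   the ideal. *)
have suppG j m : m \in msupp (G j 0) -> mdeg m = (2 * r)%N.
  move=> hm; have hd : mdeg m = d by have /dhomogP := hG j; rewrite addn0; apply.
  apply/eqP; rewrite eqn_leq spec_mon_deg ?andbT; last by have /JE/allP := JG j; apply.
  rewrite hd; have [v defX] := Jgen 0%N isT; rewrite -(mdeg_spec_gen (leq0n r)).
  rewrite -(mon_idealX k (fun m => d <= mdeg m)%N) defX mxE; apply: mon_ideal_sum => l _.
  apply: (mon_idealM (P1 := predT) (P2 := fun m => d <= mdeg m)%N); first 1 last.
  - exact: mon_idealT.
  - by have /dhomogP hGl := hG l; apply/allP => u /hGl ->; rewrite addn0.
  - by move=> u w _ /leq_trans; apply; rewrite mdegD leq_addl.
(* [C] is the scalar matrix expressing the given generators through the [spec_gen i]. *)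
pose C : 'M[Pol k]_(b 0, r.+1) := \matrix_(j, i) ((G j 0)@_(spec_gen i))%:MP.
pose X : 'cV[Pol k]_r.+1 := \col_i 'X_[spec_gen i].
have GE : G = C *m X.
  apply/matrixP => j c; rewrite (ord1 c) mxE; apply/mpolyP => m; rewrite raddf_sum /=.
  under eq_bigr => i _ do rewrite !mxE mcoeffCM mcoeffX.
  have [hm|hm] := boolP (m \in msupp (G j 0)); last first.
    rewrite (memN_msupp_eq0 hm) big1 // => i _; case: eqP => [->|]; rewrite ?mulr0 //.
    by rewrite (memN_msupp_eq0 hm) mul0r.
  have /JE/allP/(_ m hm) Pm := JG j.
  have [def_m le_m] := spec_mon_deg_gen Pm (suppG _ _ hm).
  rewrite (bigD1 (Ordinal (n := r.+1) (m := m x0) le_m)) //= -def_m eqxx mulr1 big1 ?addr0 // => i ne_i.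
  case: eqP; rewrite ?mulr0 // => eq_m; case/eqP: ne_i; apply: val_inj => /=.
  by rewrite -eq_m spec_genE.
have MG : M 0%N *m G = 0.
  by apply/row_matrixP => i; rewrite row_mul row0; apply/ex0; exists (delta_mx 0 i); rewrite -rowE.
have MC : M 0%N *m C = 0.
  apply/matrixP => l i; rewrite [RHS]mxE.
  apply: (spec_gens_linearly_free (L := fun i => (M 0%N *m C) l i)) => [{}i|].
    rewrite mxE /is_homog rpred_sum // => j _; apply: (dhomogM (d := 1) (e := 0)).
      by have := hM 0%N l j; rewrite addn0 addn1 subSnn.
    by rewrite mxE -alg_mpolyC; apply/rpredZ/dhomog1.
  have /matrixP/(_ l 0) := MG; rewrite GE mulmxA mxE => MCX.
  by move: MCX; rewrite [RHS]mxE; apply: etrans; apply: eq_bigr => j _; rewrite [X j 0]mxE.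
pose x := (U_(x0) + U_(x1))%MM; pose y := (U_(x2) + U_(x3))%MM.
have [v0 def0] := Jgen 0%N isT; have [v1 def1] := Jgen 1%N r_gt0.
have xy : (spec_gen 1 + y = spec_gen 0 + x)%MM.
  by apply: (mnm_labelsP uniq_x); rewrite !(spec_genE, mnmDE) !mnm1E !eqxx !(neq_labels uniq_x); lia.
have [w def_w] : exists w, 'X_[y] *: v1 - 'X_[x] *: v0 = w *m M 0%N.
  apply/ex0; rewrite mulmxBl -!scalemxAl [v1 *m G]mx11_scalar [v0 *m G]mx11_scalar.
  by rewrite -def0 -def1 !scale_scalar_mx -!mpolyXD addmC xy addmC subrr.
(* The entries of [M 0] are linear, so [M 0 *m C = 0]. A relation in the image of [M 0] therefore
   holds coordinatewise after applying [C]. *)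
have {w def_w} eqC : 'X_[y] *: (v1 *m C) = 'X_[x] *: (v0 *m C).
  by apply/eqP; rewrite -subr_eq0 !scalemxAl -mulmxBl def_w -mulmxA MC mulmx0.
(* By [eqC], [x0] divides each entry of [v1 *m C]. This would give every monomial of [v1 *m C *m X],
   which is [spec_gen 1], a degree above [2 * r]. *)
have := mon_idealX k (fun m => 2 * r < mdeg m)%N (spec_gen 1).
rewrite mdeg_spec_gen // ltnn def1 => /negP; apply.
rewrite GE mulmxA mxE; apply: mon_ideal_sum => i _.
apply: (@mon_idealM _ (fun m => 0 < m x0)%N (fun m => mdeg m == 2 * r)%N).
- by move=> m u m0 /eqP <-; rewrite mdegD (mdeg_labels uniq_x m); lia.
- have -> : mon_ideal (fun m => 0 < m x0)%N ((v1 *m C) 0 i) =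
            mon_ideal (fun m => 0 < m x0)%N ((v1 *m C) 0 i * 'X_[y]).
    rewrite mon_ideal_colon; apply: eq_mon_ideal => m.
    by rewrite !mnmDE !mnm1E !(neq_labels uniq_x) !addn0.
  have /rowP/(_ i) := eqC; rewrite [LHS]mxE [RHS]mxE mulrC => ->; rewrite mulrC mon_ideal_colon.
  by apply/allP => m _; rewrite !mnmDE !mnm1E eqxx; lia.
by rewrite mxE mon_idealX mdeg_spec_gen // -ltnS.
Qed.

End SpecialCurve.

(** * Linear resolutions for minimal tetrahedral curves *)

Section TetrahedralCurves.
Variable k : fieldType.
Implicit Types (C : tcurve) (m u : 'X_{1..4}).

Lemma eq_linear_res (I J : Pol k -> Prop) :
  (forall p, I p <-> J p) -> has_linear_res k I -> has_linear_res k J.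
Proof. by move=> eqIJ [d resI]; exists d; apply: eq_pure_res eqIJ resI. Qed.

Lemma tet_componentE C d p :
  ideal_span k (fun q => tet_ideal k C q /\ is_homog k d q) p <->
  mon_ideal (mdvd (deg_mons (tet_mon C) d)) p.
Proof.
rewrite -ideal_componentE; last by move=> m u; apply: tet_monD.
by split=> -[n [r [s [hs ->]]]]; exists n, r, s; split=> // j;
  have [? ?] := hs j; split=> //; apply/tet_idealE.
Qed.

Lemma eq_deg_mons P1 P2 d : P1 =1 P2 -> deg_mons P1 d = deg_mons P2 d.
Proof. by move=> eqP; rewrite /deg_mons; congr map; apply: eq_filter => m; rewrite eqP. Qed.

Lemma uniq_inord (l : seq nat) :
  all (fun i => i < 4)%N l -> uniq l -> uniq [seq inord i : 'I_4 | i <- l].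
Proof.
move=> /allP lt4; rewrite map_inj_in_uniq // => i j /lt4 hi /lt4 hj /(congr1 val).
by rewrite /= !inordK.
Qed.

Lemma min_mon_linear C x0 x1 x2 x3 p q b02 b03 b12 b13 :
  uniq [:: x0; x1; x2; x3] -> tet_mon C =1 min_mon x0 x1 x2 x3 p q b02 b03 b12 b13 ->
  (b02 + b12 < p)%N -> (b03 + b13 < p)%N -> (b02 + b03 < q)%N -> (b12 + b13 < q)%N ->
  has_linear_res k (tet_ideal k C) /\ comp_linear k (tet_ideal k C).
Proof.
move=> ux PE hp0 hp1 hq0 hq1.
have clin : comp_linear k (tet_ideal k C).
  move=> d; exists d; apply: (@eq_pure_res _ (addn d) (mon_ideal (mdvd (deg_mons (tet_mon C) d)))).
    by move=> f; rewrite tet_componentE.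
  rewrite (eq_deg_mons d PE).
  apply: (pure_res_linear_quotients k (deg_mons_uniq _ _) _ (min_mon_lq ux hp0 hp1 hq0 hq1 (d := d))).
  by move=> u; rewrite mem_deg_mons => /andP[/eqP].
split=> //; apply: eq_linear_res (clin (p + q)%N) => f.
rewrite tet_componentE tet_idealE (eq_deg_mons _ PE).
by rewrite -(eq_mon_ideal (min_mon_gen ux hp0 hp1 hq0 hq1)) (eq_mon_ideal PE).
Qed.

Lemma tet_minimal_linear C : tet_minimal C ->
  has_linear_res k (tet_ideal k C) /\ comp_linear k (tet_ideal k C).
Proof.
move=> hC; have := (hC FA, hC FB, hC FC, hC FD); rewrite /red_cond => -[[[]]] hA hB hC' hD.
(* One alternative per pair of opposite edges: each of the two exceeds the sum of the other two
   edges in both triangles of variables containing it. *)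
have : [|| [&& a2 C + a4 C < a1 C, a3 C + a5 C < a1 C, a2 C + a3 C < a6 C & a4 C + a5 C < a6 C],
           [&& a1 C + a4 C < a2 C, a3 C + a6 C < a2 C, a1 C + a3 C < a5 C & a4 C + a6 C < a5 C] |
           [&& a1 C + a5 C < a3 C, a2 C + a6 C < a3 C, a1 C + a2 C < a4 C & a5 C + a6 C < a4 C]]%N.
  by clear hC; lia.
case/or3P => /and4P[h0 h1 h2 h3].
- apply: (min_mon_linear (@uniq_inord [:: 0; 1; 2; 3]%N isT isT) _ h0 h1 h2 h3) => m.
  by rewrite /tet_mon /min_mon; lia.
- apply: (min_mon_linear (@uniq_inord [:: 0; 2; 1; 3]%N isT isT) _ h0 h1 h2 h3) => m.
  by rewrite /tet_mon /min_mon; lia.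
apply: (min_mon_linear (@uniq_inord [:: 0; 3; 1; 2]%N isT isT) _ h0 h1 h2 h3) => m.
by rewrite /tet_mon /min_mon; lia.
Qed.

(** * Special curves up to permutation *)

(** One alternative per pair of opposite edges carrying the zeros. As [a1] and [a2] are not
    opposite, their maximum is [r]. *)
Definition special_shape C :=
  let r := maxn (a1 C) (a2 C) in
  (0 < r)%N &&
  [|| [&& a1 C == 0, a2 C == r, a3 C == r, a4 C == r, a5 C == r & a6 C == 0],
      [&& a1 C == r, a2 C == 0, a3 C == r, a4 C == r, a5 C == 0 & a6 C == r] |
      [&& a1 C == r, a2 C == r, a3 C == 0, a4 C == 0, a5 C == r & a6 C == r]]%N.

Lemma special_curveP C : special_curve C <-> special_shape C.
Proof.
split=> [[s [r [r_gt0 hs]]]|].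
  have ne_s (i j : 'I_4) : i != j -> val (s i) != val (s j) by rewrite val_eqE (inj_eq perm_inj).
  pose o0 := @Ordinal 4 0 isT; pose o1 := @Ordinal 4 1 isT.
  pose o2 := @Ordinal 4 2 isT; pose o3 := @Ordinal 4 3 isT.
  have := (hs o0 o1 isT, hs o0 o2 isT, hs o0 o3 isT, hs o1 o2 isT, hs o1 o3 isT, hs o2 o3 isT).
  have : [&& val (s o0) != val (s o1), val (s o0) != val (s o2), val (s o0) != val (s o3),
             val (s o1) != val (s o2), val (s o1) != val (s o3) & val (s o2) != val (s o3)].
    by rewrite !ne_s.
  clear hs ne_s.
  case: (s o0) (s o1) (s o2) (s o3) => [n0 lt0] [n1 lt1] [n2 lt2] [n3 lt3] /=.
  case: C => c1 c2 c3 c4 c5 c6; rewrite /special_shape /=.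
  case: n0 lt0 => [|[|[|[|//]]]] _; case: n1 lt1 => [|[|[|[|//]]]] _ //=;
  case: n2 lt2 => [|[|[|[|//]]]] _ //=; case: n3 lt3 => [|[|[|[|//]]]] _ //=;
  by move=> // _ [[[[[]]]]]; lia.
case: C => c1 c2 c3 c4 c5 c6; rewrite /special_shape /= => /andP[].
set r := maxn c1 c2 => r_gt0.
have tentry_ok (s : 'S_4) : (forall i j : 'I_4, i != j ->
  tentry (TC c1 c2 c3 c4 c5 c6) (s i) (s j) = tentry (TC 0 r r r r 0) i j) ->
  special_curve (TC c1 c2 c3 c4 c5 c6) by exists s, r.
case/or3P => /and5P[/eqP e1 /eqP e2 /eqP e3 /eqP e4 /andP[/eqP e5 /eqP e6]].
(* The identity and the transpositions of [b] with [c] and of [b] with [d] realise the three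
   positions of the zeros. *)
- apply: (tentry_ok 1%g) => i j; rewrite !perm1 e1 e2 e3 e4 e5 e6.
  by case: i => [[|[|[|[|//]]]]] ?; case: j => [[|[|[|[|//]]]]].
- apply: (tentry_ok (tperm (Ordinal (isT : 1 < 4)%N) (Ordinal (isT : 2 < 4)%N))) => i j.
  rewrite !permE /= e1 e2 e3 e4 e5 e6.
  by case: i => [[|[|[|[|//]]]]] ?; case: j => [[|[|[|[|//]]]]].
apply: (tentry_ok (tperm (Ordinal (isT : 1 < 4)%N) (Ordinal (isT : 3 < 4)%N))) => i j.
rewrite !permE /= e1 e2 e3 e4 e5 e6.
by case: i => [[|[|[|[|//]]]]] ?; case: j => [[|[|[|[|//]]]]].
Qed.

Lemma spec_mon_special C x0 x1 x2 x3 r : (0 < r)%N ->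
  uniq [:: x0; x1; x2; x3] -> tet_mon C =1 spec_mon x0 x1 x2 x3 r ->
  has_pure_res k (tet_ideal k C) /\ ~ has_linear_res k (tet_ideal k C) /\
  ~ comp_linear k (tet_ideal k C).
Proof.
move=> r_gt0 ux PE.
have JE p : tet_ideal k C p <-> mon_ideal (spec_mon x0 x1 x2 x3 r) p.
  by rewrite tet_idealE (eq_mon_ideal PE).
have not_lin := spec_not_linear ux r_gt0 JE.
split; last split=> //.
  have [|b [G [M resJ]]] := eq_pure_res _ (spec_pure k ux (leqnn r.+1)) (J := tet_ideal k C).
    by move=> p; rewrite JE (eq_mon_ideal (spec_monE r ux)).
  by exists b; eexists; exists G, M; apply: resJ.
(* The ideal is generated in degree [2 * r], so it is spanned by its component of that degree. *)
move=> /(_ (2 * r)%N) lin; apply: not_lin; apply: eq_linear_res lin => p.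
rewrite tet_componentE tet_idealE (@eq_mon_ideal _ _ (tet_mon C)) // => m.
rewrite PE; apply/mdvdP/idP => [[u]|].
  rewrite mem_deg_mons PE => /andP[_ hu] le_um; rewrite -(submK le_um) -PE.
  by apply: tet_monD; rewrite PE.
rewrite (spec_monE r ux) => /mdvd_spec_gens[i le_i hi]; exists (spec_gen x0 x1 x2 x3 r i) => //.
by rewrite mem_deg_mons PE (spec_mon_gen ux) // (mdeg_spec_gen ux) ?eqxx.
Qed.

Lemma special_curve_res C : special_curve C ->
  has_pure_res k (tet_ideal k C) /\ ~ has_linear_res k (tet_ideal k C) /\
  ~ comp_linear k (tet_ideal k C).
Proof.
move=> /special_curveP; rewrite /special_shape; set r := maxn _ _ => /andP[r_gt0].
case/or3P => /and5P[/eqP e1 /eqP e2 /eqP e3 /eqP e4 /andP[/eqP e5 /eqP e6]].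
- apply: (spec_mon_special r_gt0 (@uniq_inord [:: 0; 1; 2; 3]%N isT isT)) => m.
  by rewrite /tet_mon /spec_mon; lia.
- apply: (spec_mon_special r_gt0 (@uniq_inord [:: 0; 2; 1; 3]%N isT isT)) => m.
  by rewrite /tet_mon /spec_mon; lia.
apply: (spec_mon_special r_gt0 (@uniq_inord [:: 0; 3; 1; 2]%N isT isT)) => m.
by rewrite /tet_mon /spec_mon; lia.
Qed.

(** * The monomial of a reduction as a minimal generator *)

Lemma min_generator_tet C u : min_generator k (tet_ideal k C) 'X_[u] <->
  tet_mon C u /\ forall y, (0 < u y)%N -> ~~ tet_mon C (u - U_(y)).
Proof.
rewrite /min_generator tet_idealE mon_idealX; split=> -[Pu hu]; split=> //.
  move=> y uy; apply/negP => Py; apply: hu; apply: ideal_span_id.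
  exists 'X_y, 'X_[u - U_(y)]; split; last split.
  - by apply: ideal_span_id; exists y.
  - by apply/tet_idealE; rewrite mon_idealX.
  by rewrite -mpolyXD addmC submK // lep1mP -lt0n.
(* Every monomial of the product with the maximal ideal satisfies [P]: it stays in the ideal after
   removing some variable. *)
pose P m := [exists y, (0 < m y)%N && tet_mon C (m - U_(y))].
have PD v w : P w -> P (v + w)%MM.
  case/existsP => y /andP[wy Pw]; apply/existsP; exists y; rewrite mnmDE addn_gt0 wy orbT.
  by rewrite -addmBA ?tet_monD // lep1mP -lt0n.
move=> FmI; suff : P u by case/existsP => y /andP[/hu /negP].
rewrite -(mon_idealX k); apply: ideal_span_sub_mon FmI => // _ [f [g [hf [/tet_idealE hg ->]]]].
have {}hf : mon_ideal (fun m => [exists y, 0 < m y]%N) f.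
  apply: ideal_span_sub_mon hf => [v w /existsP[y wy]|_ [y ->]].
    by apply/existsP; exists y; rewrite mnmDE addn_gt0 wy orbT.
  by rewrite mon_idealX; apply/existsP; exists y; rewrite mnm1E eqxx.
apply: mon_idealM hf hg => v w /existsP[y vy] Pw; apply/existsP; exists y.
rewrite mnmDE addn_gt0 vy /= addmC -addmBA; last by rewrite lep1mP -lt0n.
by rewrite addmC tet_monD.
Qed.

(** The [bi] are the entries of the facet and the [eij] the remaining ones; the second row bounds
    the weights of the other facets. Two tight edges share an index, whose [bi] must vanish by the
    weight bound. So some [bi] is zero, and the weight bounds make the other two equal. *)
Lemma red_arith b1 b2 b3 e12 e13 e23 :
  (e12 <= b1 + b2)%N -> (e13 <= b1 + b3)%N -> (e23 <= b2 + b3)%N ->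
  (e12 + e13 <= b2 + b3)%N -> (e12 + e23 <= b1 + b3)%N -> (e13 + e23 <= b1 + b2)%N ->
  (0 < b1 + b2 + b3)%N ->
  (b1 = 0 \/ b1 + b2 = e12 \/ b1 + b3 = e13)%N ->
  (b2 = 0 \/ b1 + b2 = e12 \/ b2 + b3 = e23)%N ->
  (b3 = 0 \/ b1 + b3 = e13 \/ b2 + b3 = e23)%N ->
  special_shape (TC b1 b2 b3 e12 e13 e23).
Proof.
move=> h12 h13 h23 w1 w2 w3 pos c1 c2 c3; rewrite /special_shape /=.
have : (b1 = 0 /\ b2 = b3 \/ b2 = 0 /\ b1 = b3 \/ b3 = 0 /\ b1 = b2)%N by lia.
case=> [|[]] [e e'].
- have [-> -> ->] : [/\ e12 = b3, e13 = b3 & e23 = 0]%N by split; lia.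
  by rewrite e e' max0n !eqxx andbT; lia.
- have [-> -> ->] : [/\ e12 = b3, e13 = 0 & e23 = b3]%N by split; lia.
  by rewrite e e' maxn0 !eqxx /= orbT andbT; lia.
have [-> -> ->] : [/\ e12 = 0, e13 = b2 & e23 = b2]%N by split; lia.
by rewrite e e' maxnn !eqxx /= !orbT andbT; lia.
Qed.

Lemma red_mono_min_generator_labels C x0 x1 x2 x3 b1 b2 b3 e12 e13 e23 :
  uniq [:: x0; x1; x2; x3] ->
  (forall m, tet_mon C m =
    [&& b1.-1 <= m x0 + m x1, b2.-1 <= m x0 + m x2, b3.-1 <= m x0 + m x3,
        e12 <= m x1 + m x2, e13 <= m x1 + m x3 & e23 <= m x2 + m x3]%N) ->
  (e12 <= b1 + b2)%N -> (e13 <= b1 + b3)%N -> (e23 <= b2 + b3)%N ->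
  (e12 + e13 <= b2 + b3)%N -> (e12 + e23 <= b1 + b3)%N -> (e13 + e23 <= b1 + b2)%N ->
  (0 < b1 + b2 + b3)%N ->
  min_generator k (tet_ideal k C) 'X_[U_(x1) *+ b1 + U_(x2) *+ b2 + U_(x3) *+ b3] <->
  special_shape (TC b1 b2 b3 e12 e13 e23).
Proof.
move=> ux PE h12 h13 h23 w1 w2 w3 pos; rewrite min_generator_tet.
set u := (_ + _ + _)%MM.
have [[u0 u1] [u2 u3]] : (u x0 = 0 /\ u x1 = b1)%N /\ (u x2 = b2 /\ u x3 = b3)%N.
  by rewrite !mnmDE !mulmnE !mnm1E !eqxx !(neq_labels ux) !mul1n !mul0n !addn0.
have dropE y : tet_mon C (u - U_(y)) =
  [&& b1.-1 <= (0 - (y == x0)) + (b1 - (y == x1)), b2.-1 <= (0 - (y == x0)) + (b2 - (y == x2)),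
      b3.-1 <= (0 - (y == x0)) + (b3 - (y == x3)), e12 <= (b1 - (y == x1)) + (b2 - (y == x2)),
      e13 <= (b1 - (y == x1)) + (b3 - (y == x3)) & e23 <= (b2 - (y == x2)) + (b3 - (y == x3))]%N.
  by rewrite PE !mnmBE !mnm1E u0 u1 u2 u3.
split=> [[_ min_u]|shape].
  (* The reduction lowers the edges at [x0] by one, so dividing by a variable of the monomial can
     only violate one of the [eij]. *)
  have := (min_u x1, min_u x2, min_u x3); rewrite !dropE u1 u2 u3 !eqxx !(neq_labels ux).
  rewrite !subn0 !add0n => -[[c1 c2] c3]; clear min_u dropE.
  by apply: red_arith => //; [clear c2 c3 | clear c1 c3 | clear c1 c2]; lia.
split; first by rewrite PE u0 u1 u2 u3; clear shape dropE; lia.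
move=> y; rewrite dropE; have := mem_labels ux y; rewrite !inE.
move: shape; rewrite /special_shape /= => /andP[r_gt0 /or3P[] /and5P[? ? ? ? /andP[? ?]]];
  case/or4P => /eqP ->; rewrite ?u0 ?u1 ?u2 ?u3 !eqxx !(neq_labels ux); clear dropE; lia.
Qed.

(** This and the next two lemmas are the transpositions of [a, b], of [b, c] and of [c, d] acting on
    the entries; composed, they carry any facet to the one at [a]. *)
Lemma special_shape_swapA b1 b2 b3 b4 b5 b6 :
  special_shape (TC b1 b4 b5 b2 b3 b6) = special_shape (TC b1 b2 b3 b4 b5 b6).
Proof.
rewrite /special_shape /=.
by apply/idP/idP=> /andP[? /or3P[] /and5P[? ? ? ? /andP[? ?]]]; lia.
Qed.

Lemma special_shape_swapC b1 b2 b3 b4 b5 b6 :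
  special_shape (TC b2 b1 b3 b4 b6 b5) = special_shape (TC b1 b2 b3 b4 b5 b6).
Proof.
rewrite /special_shape /=.
by apply/idP/idP=> /andP[? /or3P[] /and5P[? ? ? ? /andP[? ?]]]; lia.
Qed.

Lemma special_shape_swapD b1 b2 b3 b4 b5 b6 :
  special_shape (TC b1 b3 b2 b5 b4 b6) = special_shape (TC b1 b2 b3 b4 b5 b6).
Proof.
rewrite /special_shape /=.
by apply/idP/idP=> /andP[? /or3P[] /and5P[? ? ? ? /andP[? ?]]]; lia.
Qed.

Lemma var_monE (i j l n1 n2 n3 : nat) :
  var k i ^+ n1 * var k j ^+ n2 * var k l ^+ n3 =
  'X_[U_(inord i) *+ n1 + U_(inord j) *+ n2 + U_(inord l) *+ n3].
Proof. by rewrite /var !mpolyXn !mpolyXD. Qed.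

Lemma red_mono_min_generator C X : nontrivial C -> red_cond C X ->
  (forall Y, facet_weight C Y <= facet_weight C X)%N ->
  min_generator k (tet_ideal k (red_target C X)) (red_mono k C X) <-> special_curve C.
Proof.
move=> ntC redX maxX; rewrite special_curveP.
have := (maxX FA, maxX FB, maxX FC, maxX FD); move: ntC redX; clear maxX.
case: C => c1 c2 c3 c4 c5 c6; case: X; rewrite /red_mono var_monE /nontrivial /facet_weight /=;
  move=> ntC [r1 [r2 r3]] [[[wA wB] wC] wD].
(* In each case the linear form of the reduction is labelled first, so the facet entries become
   [b1], [b2], [b3]. *)
- by apply: (red_mono_min_generator_labels (@uniq_inord [:: 0; 1; 2; 3]%N isT isT)) => //; lia.
- rewrite -special_shape_swapA.
  apply: (red_mono_min_generator_labels (@uniq_inord [:: 1; 0; 2; 3]%N isT isT));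
    [by move=> m; rewrite /tet_mon /=; clear; lia | lia..].
- rewrite -special_shape_swapC -special_shape_swapA.
  apply: (red_mono_min_generator_labels (@uniq_inord [:: 2; 0; 1; 3]%N isT isT));
    [by move=> m; rewrite /tet_mon /=; clear; lia | lia..].
rewrite -special_shape_swapD -special_shape_swapC -special_shape_swapA.
apply: (red_mono_min_generator_labels (@uniq_inord [:: 3; 0; 1; 2]%N isT isT));
    [by move=> m; rewrite /tet_mon /=; clear; lia | lia..].
Qed.

End TetrahedralCurves.

Theorem theorem4p8 (k : fieldType) (C : tcurve) :
  nontrivial C ->
  (* (a) *)
  (tet_minimal C ->
     has_linear_res k (tet_ideal k C) /\ comp_linear k (tet_ideal k C)) /\
  (* (b) *)
  (special_curve C ->
     has_pure_res k (tet_ideal k C) /\ ~ has_linear_res k (tet_ideal k C) /\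
     ~ comp_linear k (tet_ideal k C)) /\
  (* (c) *)
  (forall X : facet,
     red_cond C X ->
     (forall Y : facet, (facet_weight C Y <= facet_weight C X)%N) ->
     (min_generator k (tet_ideal k (red_target C X)) (red_mono k C X)
        <-> special_curve C)).
Proof.
move=> ntC; split; first exact: tet_minimal_linear.
split; first exact: special_curve_res.
by move=> X; apply: red_mono_min_generator.
Qed.
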